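(* Let $d \ge 1$, let $K \subset \mathbb{R}^d$ be a bounded set with $|K| = 1$ and $|\partial K| = 0$, let $A \subset \mathbb{R}^d$ be a fixed bounded convex set with nonempty interior and $|A| = 1$, and let $\alpha \in (0,1)$. Let $X_1, X_2, \ldots$ be i.i.d. random vectors on a probability space $(\Omega, \mathcal{A}, \mathbb{P})$ taking values in $K$, and let $V_n$ be the volume of the maximum spacing (with respect to $A$) generated by $X_1, \ldots, X_n$ in $K$. Suppose that $X_1$ has a Lebesgue density $f$. If there is some $\varepsilon > 0$ and some (solid, nondegenerate) ball $S \subset K$ such that $f(x) \le 1 - \varepsilon$ for each $x \in S$, then $$\lim_{n \to \infty} \mathbb{P}(V_n > c_{n,\alpha}) = 1,$$ where $$c_{n,\alpha} = \frac{g_{1-\alpha} + \log n + (d-1)\log\log n + \beta}{n}.$$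
   Context: $|\cdot|$ denotes Lebesgue measure on $\mathbb{R}^d$ and $\partial K$ is the boundary of $K$. The maximum spacing with respect to the reference set $A$ generated by $X_1,\ldots,X_n$ in $K$ is $$\Delta_n = \sup\{ r > 0 : \exists\, x \in \mathbb{R}^d \text{ with } x + rA \subset K \setminus \{X_1, \ldots, X_n\}\},$$ and its volume is $V_n = \Delta_n^d$. $G(t) = \exp(-\exp(-t))$, $t \in \mathbb{R}$, is the distribution function of the Gumbel extreme value distribution, and $g_{1-\alpha}$ is its $(1-\alpha)$-quantile, i.e. $G(g_{1-\alpha}) = 1-\alpha$. The constant $\beta \in \mathbb{R}$ depends only on $A$ (through its boundary; $\beta = 0$ if $A$ is a cube). It is the constant appearing in the following known theorem of Janson (1987): for every bounded set $K \subset \mathbb{R}^d$ with $|K|=1$ and $|\partial K| = 0$, if $X_1, X_2, \ldots$ are i.i.d. with the uniform distribution over $K$, then $$\lim_{n\to\infty} \mathbb{P}\left( nV_n - \log n - (d-1)\log\log n - \beta \le t\right) = G(t), \quad t \in \mathbb{R}.$$ This limit relation determines $\beta$ uniquely. *)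

(* Defs.v *)
From HB Require Import structures.
From mathcomp Require Import all_boot all_order all_algebra finmap.
From mathcomp Require Import all_classical all_reals all_analysis.

Set Implicit Arguments.
Unset Strict Implicit.
Unset Printing Implicit Defensive.

Import Order.TTheory GRing.Theory Num.Theory.
Import numFieldNormedType.Exports.

Local Open Scope classical_set_scope.
Local Open Scope ring_scope.

(* R^d is 'rV[R]_d, with its Borel sigma-algebra.  Its library norm is the sup
   norm: it induces the usual topology and bounded sets, but its balls are
   cubes. *)
HB.instance Definition _ (R : realType) (d : nat) :=
  @isMeasurable.Build (sigma_display (@open 'rV[R]_d)) 'rV[R]_d
    <<s @open 'rV[R]_d >> (@sigma_algebra0 _ setT (@open 'rV[R]_d))
    (@sigma_algebraC 'rV[R]_d (@open 'rV[R]_d))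
    (@sigma_algebra_bigcup _ setT (@open 'rV[R]_d)).

Section product_measure_cons.
Context d (T : measurableType d) (R : realType) (n : nat).
Variable mu : {sigma_finite_measure set T -> \bar R}.
Variable nu : {sigma_finite_measure set (n.-tuple T) -> \bar R}.
Local Open Scope ereal_scope.

Let consT (x : T * n.-tuple T) : n.+1.-tuple T := [tuple of x.1 :: x.2].

Let measurable_consT : measurable_fun [set: T * n.-tuple T] consT.
Proof. exact: measurable_cons. Qed.

Definition product_measure_cons : set (n.+1.-tuple T) -> \bar R :=
  pushforward (mu \x nu) consT.

Let product_measure_cons0 : product_measure_cons set0 = 0.
Proof. by rewrite /product_measure_cons /pushforward preimage_set0 measure0. Qed.

Let product_measure_cons_ge0 A : 0 <= product_measure_cons A.
Proof. exact: measure_ge0. Qed.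

Let product_measure_cons_sigma_additive :
  semi_sigma_additive product_measure_cons.
Proof.
move=> F mF tF mUF; rewrite /product_measure_cons /pushforward preimage_bigcup.
apply: measure_semi_sigma_additive.
- by move=> k; rewrite -[X in measurable X]setTI; exact: measurable_consT.
- apply/trivIsetP => /= i j _ _ ij; rewrite -preimage_setI.
  by move/trivIsetP : tF => /(_ _ _ _ _ ij) ->//; rewrite preimage_set0.
- by rewrite -preimage_bigcup -[X in measurable X]setTI; exact: measurable_consT.
Qed.

HB.instance Definition _ := isMeasure.Build _ _ _ product_measure_cons
  product_measure_cons0 product_measure_cons_ge0
  product_measure_cons_sigma_additive.

Let unconsT (t : n.+1.-tuple T) : T * n.-tuple T :=
  (thead t, [tuple of behead t]).

Let measurable_unconsT : measurable_fun [set: n.+1.-tuple T] unconsT.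
Proof.
apply: measurable_fun_pair; first exact: measurable_tnth.
exact: measurable_behead.
Qed.

Let consTK : cancel consT unconsT.
Proof. by move=> [x t]; congr pair; apply/val_inj. Qed.

Let product_measure_cons_sigma_finite : sigma_finite setT product_measure_cons.
Proof.
have /sigma_finiteP[F [TF ndF Foo]] := sigma_finiteT mu.
have /sigma_finiteP[G [TG ndG Goo]] := sigma_finiteT nu.
exists (fun k => unconsT @^-1` (F k `*` G k)).
  rewrite -preimage_bigcup (_ : \bigcup_k _ = setT) ?preimage_setT//.
  apply/seteqP; split => // -[x t] _.
  have [i _ Fix] : (\bigcup_k F k) x by rewrite -TF.
  have [j _ Gjt] : (\bigcup_k G k) t by rewrite -TG.
  exists (maxn i j) => //; split => /=.
    exact: (subsetPset _ _ (ndF _ _ (leq_maxl i j))).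
  exact: (subsetPset _ _ (ndG _ _ (leq_maxr i j))).
move=> k; have [mFk Fkoo] := Foo k; have [mGk Gkoo] := Goo k; split.
  by rewrite -[X in measurable X]setTI; apply: measurable_unconsT => //;
    exact: measurableX.
rewrite /product_measure_cons /pushforward -comp_preimage.
rewrite (_ : unconsT \o consT = id); last first.
  by apply/funext => x /=; rewrite consTK.
by rewrite preimage_id product_measure1E// lte_mul_pinfty// ge0_fin_numE.
Qed.

HB.instance Definition _ := Measure_isSigmaFinite.Build _ _ _
  product_measure_cons product_measure_cons_sigma_finite.

End product_measure_cons.

Fixpoint tuple_measure d (T : measurableType d) (R : realType)
    (mu : {sigma_finite_measure set T -> \bar R}) (n : nat) :
    {sigma_finite_measure set (n.-tuple T) -> \bar R} :=
  match n with
  | 0 => dirac [tuple]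
  | n'.+1 => product_measure_cons mu (tuple_measure mu n')
  end.

(* Lebesgue measure on R^d: the outer measure generated by the d-fold product of
   the Lebesgue measure on R, read on row vectors.  It is defined on all sets,
   and restricts to a complete measure on its Caratheodory sigma-algebra, i.e.
   on the Lebesgue measurable sets. *)
Definition lebesgue_rV (R : realType) (d : nat) (A : set 'rV[R]_d) : \bar R :=
  ((tuple_measure (@lebesgue_measure R) d)^*)%mu
    [set t | A (\row_(i < d) tnth t i)].

Section lebesgue_rV_outer_measure.
Variables (R : realType) (d : nat).
Local Open Scope ereal_scope.

Let lebesgue_rV0 : lebesgue_rV (@set0 'rV[R]_d) = 0.
Proof. exact: outer_measure0. Qed.

Let lebesgue_rV_ge0 (A : set 'rV[R]_d) : 0 <= lebesgue_rV A.
Proof. exact: outer_measure_ge0. Qed.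

Let le_lebesgue_rV :
  {homo @lebesgue_rV R d : A B / A `<=` B >-> A <= B}.
Proof. by move=> A B AB; apply: le_outer_measure => t /=; exact: AB. Qed.

Let lebesgue_rV_sigma_subadditive : sigma_subadditive (@lebesgue_rV R d).
Proof.
move=> F; rewrite /lebesgue_rV.
rewrite (_ : mkset _ =
    \bigcup_k [set t | F k (\row_(i < d) tnth t i)]); last first.
  by apply/seteqP; split.
exact: outer_measure_sigma_subadditive.
Qed.

HB.instance Definition _ := isOuterMeasure.Build R 'rV[R]_d (@lebesgue_rV R d)
  lebesgue_rV0 lebesgue_rV_ge0 le_lebesgue_rV lebesgue_rV_sigma_subadditive.

End lebesgue_rV_outer_measure.

Notation lebesgue_type R d := (caratheodory_type (@lebesgue_rV R d)).

Definition boundary (T : topologicalType) (K : set T) : set T :=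
  closure K `\` K°.

Definition euclidean_ball (R : realType) (d : nat) (c : 'rV[R]_d) (r : R) :
    set 'rV[R]_d :=
  [set x | Num.sqrt (\sum_(i < d) (x ord0 i - c ord0 i) ^+ 2) <= r].

Section spacing.
Variables (R : realType) (d : nat).

Definition homothet (A : set 'rV[R]_d) (x : 'rV[R]_d) (r : R) : set 'rV[R]_d :=
  [set x + r *: a | a in A].

Definition max_spacing (A K pts : set 'rV[R]_d) : R :=
  sup [set r : R | 0 < r /\ exists x, homothet A x r `<=` K `\` pts].

(* Sequences of points are indexed from 0: the first n points are
   x 0, ..., x n.-1. *)
Definition max_spacing_volume (A K : set 'rV[R]_d) (x : nat -> 'rV[R]_d)
    (n : nat) : R :=
  max_spacing A K [set x i | i in `I_n] ^+ d.

End spacing.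

Section random_vectors.
Context (dO dT : measure_display) (Omega : measurableType dO)
  (T : measurableType dT) (R : realType) (P : probability Omega R).
Local Open Scope ereal_scope.

Definition mutually_independent (I : choiceType) (X : I -> {RV P >-> T}) :=
  forall (J : {fset I}) (B : I -> set T), (forall i, measurable (B i)) ->
    P (\bigcap_(i in [set` J]) X i @^-1` B i) =
    \prod_(i <- J) P (X i @^-1` B i).

Definition identically_distributed (I : Type) (X : I -> {RV P >-> T}) :=
  forall i j (B : set T), measurable B ->
    distribution P (X i) B = distribution P (X j) B.

Definition iid (I : choiceType) (X : I -> {RV P >-> T}) :=
  mutually_independent X /\ identically_distributed X.

End random_vectors.

Section laws.
Context (dO : measure_display) (Omega : measurableType dO) (R : realType)
  (P : probability Omega R) (d : nat).
Local Open Scope ereal_scope.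

Definition has_lebesgue_density (X : {RV P >-> 'rV[R]_d})
    (f : 'rV[R]_d -> R) :=
  [/\ measurable_fun [set: lebesgue_type R d] f,
      forall x, (0 <= f x)%R &
      forall B : set 'rV[R]_d, measurable B ->
        distribution P X B =
        \int[(@lebesgue_rV R d : set (lebesgue_type R d) -> \bar R)]_(x in B)
          (f x)%:E].

(* K is understood to have Lebesgue measure 1. *)
Definition uniformly_distributed (K : set 'rV[R]_d)
    (X : {RV P >-> 'rV[R]_d}) :=
  forall B : set 'rV[R]_d, measurable B ->
    distribution P X B = lebesgue_rV (K `&` B).

End laws.

Definition gumbel_cdf (R : realType) (t : R) : R := expR (- expR (- t)).

(* beta satisfies the limit relation of Janson's theorem for the reference set
   A, which determines it uniquely. *)
Definition janson_constant (R : realType) (d : nat) (A : set 'rV[R]_d)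
    (beta : R) : Prop :=
  forall (K : set 'rV[R]_d),
    bounded_set K -> lebesgue_rV K = 1%E -> lebesgue_rV (boundary K) = 0%E ->
  forall (dO : measure_display) (Omega : measurableType dO)
    (P : probability Omega R) (X : nat -> {RV P >-> 'rV[R]_d}),
    iid X -> (forall i, uniformly_distributed K (X i)) ->
  forall t : R,
    P [set w | n%:R * max_spacing_volume A K (X ^~ w) n - ln n%:R
                 - (d%:R - 1) * ln (ln n%:R) - beta <= t]
      @[n --> \oo] --> (gumbel_cdf t)%:E.

(* Main.v *)
Require Import Defs.
From HB Require Import structures.
From mathcomp Require Import all_boot all_order all_algebra finmap.
From mathcomp Require Import all_classical all_reals all_analysis.
From mathcomp Require Import measurable_realfun.
From mathcomp Require Import ring lra.

Set Implicit Arguments.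
Unset Strict Implicit.
Unset Printing Implicit Defensive.

Import Order.TTheory GRing.Theory Num.Theory.
Import numFieldNormedType.Exports.

Local Open Scope classical_set_scope.
Local Open Scope ring_scope.

(** The density is at most 1 - e on a ball S, so a set of volume v inside S is
hit by a sample point with probability at most (1 - e) v only.  Take cells
of volume v = (1 + e) (log n) / n: each of them is missed by all n points with
probability at least about exp (- (1 - e^2) log n) = n^(e^2 - 1), whereas S
contains of the order of n / log n disjoint translates of a homothet of A of
that volume.  The expected number of empty cells is thus at least of order
n^(e^2) / log n, which tends to infinity.  The events that two disjoint cells
are empty are negatively correlated, because (1 - p - q)^n is at most
((1 - p) (1 - q))^n; hence the variance of the number of empty cells is at most
its mean, and by the second moment method ([second_moment],
[empty_cell_bound]) some cell is empty with probability tending to one.  An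
empty cell is an empty homothet of A of volume v inside K, and v exceeds the
threshold of the theorem for large n, since the latter is
(log n + O(log log n)) / n.

Three points need care.  The volume of x + s A is at most s^d |A| because the
product measure transforms like the one-dimensional Lebesgue measure under
coordinatewise affine maps ([tuple_measure_affine], [lebesgue_rV_homothet]).
The density is integrated with respect to the Caratheodory sigma-algebra of
Lebesgue measure, to which open sets belong because they are countable unions
of rational boxes ([open_lebesgue_measurable], [density_le]); the cells are
therefore homothets of the interior of A.  Finally, K and A need not be Borel
sets, and the event that the maximum spacing exceeds s has to be shown
measurable: shrinking a homothet of a convex body leaves room to move its
centre ([homothet_shrink]), so this event is a countable union, over homothets
with rational centre and ratio, of the events that the open homothet is missed
by the points ([lt_max_spacing_ratP], [measurable_lt_max_spacing]). *)

(** * Lebesgue measure under affine maps *)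

Lemma pushforward_measure_exists d1 d2 (T1 : measurableType d1)
    (T2 : measurableType d2) (R : realType) (mu : {measure set T1 -> \bar R})
    (phi : T1 -> T2) : measurable_fun [set: T1] phi ->
  {nu : {measure set T2 -> \bar R} | forall B, nu B = mu (phi @^-1` B)}.
Proof.
move=> mphi.
by unshelve eexists (pushforward mu phi : {measure set T2 -> \bar R}).
Qed.

(** The shifts are indexed by [nat] rather than ['I_n] so that removing the
first coordinate of a tuple shifts them without casts. *)
Definition affine_tuple (R : realType) (n : nat) (b : nat -> R) (k : R)
    (t : n.-tuple R) : n.-tuple R :=
  [tuple b i + k * tnth t i | i < n].

Section scaling.
Variable R : realType.
Local Open Scope ereal_scope.
Implicit Types (k : R) (b : nat -> R).

Lemma measurable_affine (b k : R) :
  measurable_fun [set: measurableTypeR R]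
    (fun x : measurableTypeR R => (b + k * x)%R : measurableTypeR R).
Proof. by apply: measurable_funD => //; exact: measurable_funM. Qed.

Lemma measurable_affine_tuple n b k :
  measurable_fun [set: n.-tuple (measurableTypeR R)]
    (affine_tuple b k : _ -> n.-tuple (measurableTypeR R)).
Proof.
apply/measurable_fun_tnthP => i.
rewrite (_ : _ \o _ = (fun x : R => (b i + k * x)%R) \o (fun t => tnth t i)).
  by apply: measurableT_comp; [exact: measurable_affine|exact: measurable_tnth].
by apply/funext => t /=; rewrite tnth_mktuple.
Qed.

Lemma lebesgue_measure_affine (b k : R) (B : set R) : (0 < k)%R ->
    measurable (B : set (measurableTypeR R)) ->
  lebesgue_measure B =
  k%:E * lebesgue_measure ((fun x : R => (b + k * x)%R) @^-1` B).
Proof.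
move=> k0 mB.
have [nu nuE] :=
  pushforward_measure_exists (@lebesgue_measure R) (measurable_affine b k).
rewrite (@lebesgue_measure_unique R (mscale (NngNum (ltW k0)) nu) _ B mB).
  by rewrite /= /mscale /= nuE.
move=> _ [[x y] _ <-] /=; rewrite /= /mscale /= nuE.
rewrite (_ : _ @^-1` _ = `](x - b) / k, (y - b) / k]%classic)%R; last first.
  apply/seteqP; split => z /=; rewrite !in_itv/=;
    by rewrite ltr_pdivrMr// ler_pdivlMr// ltrBlDl lerBrDl mulrC.
rewrite lebesgue_measure_itv [X in _ = _ * X]lebesgue_measure_itv/= !lte_fin.
rewrite ltr_pM2r ?invr_gt0// ltrD2r.
case: ifP => _; last by rewrite mule0.
by rewrite -!EFinD -EFinM; congr (_%:E); field; rewrite gt_eqF.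
Qed.

(** Induction on the dimension: the rescaled image of the product measure agrees
with the product measure on rectangles, and this determines it. *)
Lemma tuple_measure_affine n b k (B : set (n.-tuple (measurableTypeR R))) :
    (0 < k)%R -> measurable B ->
  tuple_measure (@lebesgue_measure R) n B =
  (k ^+ n)%:E *
    tuple_measure (@lebesgue_measure R) n (affine_tuple b k @^-1` B).
Proof.
move=> k0; elim: n b B => [|n IH] b B mB.
  rewrite expr0 mul1e /=; congr (dirac _ _).
  by apply/seteqP; split => t /=; rewrite (tuple0 t) [affine_tuple _ _ _]tuple0.
rewrite /=/product_measure_cons /pushforward.
set mu := @lebesgue_measure R; set tau := tuple_measure _ _.
pose phi (x : measurableTypeR R * n.-tuple (measurableTypeR R)) :
    measurableTypeR R * n.-tuple (measurableTypeR R) :=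
  ((b 0%N + k * x.1)%R, affine_tuple (fun i => b i.+1) k x.2).
have mphi : measurable_fun setT phi.
  apply: measurable_fun_pair.
    exact: (measurableT_comp (measurable_affine _ _) measurable_fst).
  exact: (measurableT_comp (measurable_affine_tuple _ _) measurable_snd).
have [nu nuE] := pushforward_measure_exists (mu \x tau) mphi.
have kn0 : (0 <= k ^+ n.+1)%R by rewrite exprn_ge0// ltW.
set C := _ @^-1` B.
have mC : measurable C.
  rewrite /C -[X in measurable X]setTI; exact: measurable_cons.
rewrite (@product_measure_unique _ _ _ _ _ mu tau
  (mscale (NngNum kn0) nu) _ C mC).
  have affine_cons x (t : n.-tuple R) : affine_tuple b k [tuple of x :: t] =
      [tuple of (b 0%N + k * x)%R :: affine_tuple (fun i => b i.+1) k t].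
    apply: eq_from_tnth => i; rewrite tnth_mktuple.
    have [j ->|->] := unliftP ord0 i; last by rewrite !tnth0.
    by rewrite !tnthS tnth_mktuple.
  rewrite /= /mscale /= nuE; congr (_ * (mu \x tau) _).
  by apply/seteqP; split => -[x t]; rewrite /C /= affine_cons.
move=> A1 A2 mA1 mA2; rewrite /= /mscale /= nuE.
rewrite (_ : _ @^-1` _ = ((fun x => (b 0%N + k * x)%R) @^-1` A1) `*`
  (affine_tuple (fun i => b i.+1) k @^-1` A2))//.
rewrite [X in _ * X = _]product_measure1E; last 2 first.
- by rewrite -[X in measurable X]setTI; exact: measurable_affine.
- by rewrite -[X in measurable X]setTI; exact: measurable_affine_tuple.
rewrite /mu (lebesgue_measure_affine (b 0%N) k0 mA1).
rewrite /tau (IH (fun i => b i.+1) A2 mA2).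
by rewrite exprS EFinM muleACA.
Qed.

End scaling.

(** * Lebesgue measure and densities on the row space *)

Section row_space.
Context {R : realType} {d : nat}.
Implicit Types (x y : 'rV[R]_d) (e : R) (U : set 'rV[R]_d).

Lemma ball_rVP x e y : 0 < e ->
  ball x e y <-> forall i, `|x ord0 i - y ord0 i| < e.
Proof.
move=> e0; split=> [[_ xy] i|xy]; first exact: xy.
by split=> // i j; rewrite (ord1 i); exact: xy.
Qed.

Lemma rat_row_dense x e : 0 < e ->
  exists q : 'rV[rat]_d, ball x e (map_mx ratr q).
Proof.
move=> e0.
have /fin_all_exists[q qP] (i : 'I_d) :
    exists q : rat, ratr q \in `]x ord0 i - e, x ord0 i + e[.
  by apply: rat_in_itvoo; rewrite ltrBlDr -addrA ltrDl addr_gt0.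
exists (\row_i q i); apply/ball_rVP => // i.
by rewrite !mxE; move: (qP i); rewrite in_itv/= ltr_distlC.
Qed.

Lemma open_rat_cover U : open U ->
  U = \bigcup_(p in [set p : 'rV[rat]_d * nat |
         ball (map_mx ratr p.1 : 'rV[R]_d) p.2.+1%:R^-1 `<=` U])
       ball (map_mx ratr p.1 : 'rV[R]_d) p.2.+1%:R^-1.
Proof.
move=> oU; apply/seteqP; split=> [x Ux|x [p pU]]; last exact: pU.
have /nbhs_ballP[e /= e0 xeU] : nbhs x U by move: oU; rewrite openE; exact.
pose m := Num.truncn (2 / e).
have m0 : (0 : R) < m.+1%:R^-1 by rewrite invr_gt0.
have me : m.+1%:R^-1 + m.+1%:R^-1 <= e.
  have : 2 / e < m.+1%:R by exact: truncnS_gt.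
  rewrite ltr_pdivrMr// => /ltW h; rewrite -mulr2n -[_ *+ 2]mulr_natl.
  by rewrite ler_pdivrMr// mulrC.
have [q xq] := rat_row_dense x m0.
exists (q, m) => /=; last exact: ball_sym.
move=> y qy; apply: xeU; apply: le_ball me _ _; exact: ball_triangle xq qy.
Qed.

Lemma measurable_open_tuple U : open U ->
  measurable [set t : d.-tuple (measurableTypeR R) | U (\row_i tnth t i)].
Proof.
move=> /open_rat_cover ->.
rewrite (_ : mkset _ = \bigcup_(p in [set p : 'rV[rat]_d * nat |
         ball (map_mx ratr p.1 : 'rV[R]_d) p.2.+1%:R^-1 `<=` U])
   \bigcap_(i in [set: 'I_d]) (tnth (T := measurableTypeR R) ^~ i @^-1`
      ball (ratr (p.1 ord0 i) : R) p.2.+1%:R^-1)); last first.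
  apply/seteqP; split=> t /= [p pU tp]; exists p => //.
    move=> i _ /=; have /ball_rVP /(_ i) := tp.
    by rewrite !mxE; apply.
  by apply/ball_rVP => // i; rewrite !mxE; exact: tp.
rewrite bigcup_mkcond; apply: countable_bigcupT_measurable => // p.
case: ifPn => // _; apply: fin_bigcap_measurable => // i _.
by rewrite -[X in measurable X]setTI; apply: measurable_tnth => //;
  exact: measurable_ball.
Qed.

Lemma open_lebesgue_measurable U : open U ->
  measurable (U : set (lebesgue_type R d)).
Proof.
move=> oU; change (caratheodory_measurable (@lebesgue_rV R d) U) => Y.
have := @caratheodory_measurable_mu_ext _ R _
  (tuple_measure (@lebesgue_measure R) d) _ (measurable_open_tuple oU).
by move/(_ [set t | Y (\row_i tnth t i)]); exact.
Qed.

(** Every countable measurable cover of B is carried by the homothety to a cover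
of its image, and [tuple_measure_affine] compares the total measures; the
covers of B are all that defines its outer measure, so B is arbitrary. *)
Lemma lebesgue_rV_homothet (B : set 'rV[R]_d) x s : 0 < s ->
  (lebesgue_rV (homothet B x s) <= (s ^+ d)%:E * lebesgue_rV B)%E.
Proof.
move=> s0; have sd0 : 0 < s ^+ d by rewrite exprn_gt0.
rewrite {2}/lebesgue_rV /mu_ext -ereal_inf_pZl//.
apply: le_ereal_inf_tmp => _ [_ [F [mF BF] <-] <-].
rewrite -nneseriesZl//.
pose b i := - nth 0 [tuple x ord0 i | i < d] i / s.
pose G k := affine_tuple b s^-1 @^-1` F k.
have mG k : measurable (G k).
  by rewrite -[X in measurable X]setTI; exact: measurable_affine_tuple.
apply: ereal_inf_lbound; exists G.
  split=> // t [a Ba at_]; pose ta := [tuple a ord0 i | i < d].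
  have [k _ Fk] : (\bigcup_k F k) ta.
    apply: BF => /=; rewrite (_ : \row_i _ = a)//.
    by apply/rowP => i; rewrite mxE tnth_mktuple.
  exists k => //; rewrite /G /= (_ : affine_tuple _ _ _ = ta)//.
  apply: eq_from_tnth => i; rewrite !tnth_mktuple /b -tnth_nth tnth_mktuple.
  have := congr1 (fun v : 'rV[R]_d => v ord0 i) at_.
  by rewrite /= !mxE => <-; field; rewrite gt_eqF.
apply: eq_eseriesr => k _.
rewrite (@tuple_measure_affine _ _ b s^-1 _ _ (mF k)) ?invr_gt0//.
by rewrite muleA -EFinM -exprMn divff ?gt_eqF// expr1n mul1e.
Qed.

Lemma density_le (dO : measure_display) (Omega : measurableType dO)
    (P : probability Omega R) (X : {RV P >-> 'rV[R]_d}) (f : 'rV[R]_d -> R)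
    (U : set 'rV[R]_d) (q : R) :
    has_lebesgue_density X f -> open U -> 0 <= q ->
    (forall x, U x -> f x <= q) ->
  (P (X @^-1` U) <= q%:E * lebesgue_rV U)%E.
Proof.
move=> [mf f0 fX] oU q0 fq.
have mU := open_lebesgue_measurable oU.
have -> : P (X @^-1` U) = distribution P X U by [].
rewrite fX; last exact: sub_sigma_algebra.
(* The measure structure on the Caratheodory type is keyed on a bundled outer
   measure. *)
pose mo : {outer_measure set 'rV[R]_d -> \bar R} := @lebesgue_rV R d.
pose mu : {measure set (caratheodory_type mo) -> \bar R} :=
  (mo : set (caratheodory_type mo) -> \bar R).
rewrite -[leRHS](@integral_cst _ _ _ mu _ mU).
apply: (@ge0_le_integral _ _ _ mu _ mU) => //.
- by move=> x _; rewrite lee_fin.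
- by apply/measurable_EFinP; apply: measurable_funTS.
Qed.

End row_space.

(** * Homothets of a convex body and the maximum spacing *)

Lemma bounded_set_lt (R : realType) (V : normedModType R) (B : set V) :
  bounded_set B -> exists2 M : R, 0 < M & forall x, B x -> `|x| < M.
Proof.
move=> [M [_ MB]]; exists (`|M| + 2); first by rewrite ltr_wpDl.
move=> x Bx; apply: (@le_lt_trans _ _ (`|M| + 1)); last by rewrite ltrD2l ltr1n.
by apply: (MB (`|M| + 1)) => //; rewrite (le_lt_trans (ler_norm _))// ltrDl.
Qed.

Lemma convex_set_conv (R : realType) (V : lmodType R)
    (A : set (convex_lmodType V)) (x y : V) (t : R) :
  convex_set A -> A x -> A y -> 0 <= t -> t <= 1 ->
  A (t *: x + (1 - t) *: y).
Proof.
move=> cA Ax Ay t0 t1; have := cA x y (Itv01 t0 t1); rewrite !inE; exact.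
Qed.

Lemma continuous_affine (R : realType) (V : normedModType R) (b x : V) (k : R) :
  continuous (fun y : V => b + k *: (y - x)).
Proof.
move=> y; apply: cvgD; first exact: cvg_cst.
apply: cvgZ; first exact: cvg_cst.
by apply: cvgB; [exact: cvg_id|exact: cvg_cst].
Qed.

Section homothets.
Variables (R : realType) (d : nat).
Implicit Types (A K pts : set 'rV[R]_d) (x y : 'rV[R]_d) (r s : R).

Lemma homothetS A B x r : A `<=` B -> homothet A x r `<=` homothet B x r.
Proof. by move=> AB _ [a Aa <-]; exists a => //; exact: AB. Qed.

Lemma homothetE A x r : r != 0 ->
  homothet A x r = (fun y => r^-1 *: (y - x)) @^-1` A.
Proof.
move=> r0; apply/seteqP; split=> [_ [a Aa <-]|y Ay] /=.
  by rewrite addrC addKr scalerK.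
by exists (r^-1 *: (y - x)) => //; rewrite scalerKV// subrKC.
Qed.

Lemma open_homothet A x r : 0 < r -> open A -> open (homothet A x r).
Proof.
move=> r0 oA; rewrite homothetE ?gt_eqF//; apply: open_comp => // y _.
by have := @continuous_affine R _ 0 x r^-1 y; under eq_fun do rewrite add0r.
Qed.

(** A point x + r a of the small homothet is x0 + r0 z, where z is a convex
combination of a and of a' = (x - x0) / (r0 - r).  The condition on x says that
a' lies in the open ball around a0; moving a' within that ball moves z within A,
so z is an interior point of A. *)
Lemma homothet_shrink A (a0 : 'rV[R]_d) (e : R) x0 r0 r x :
    convex_set (A : set (convex_lmodType 'rV[R]_d)) -> ball a0 e `<=` A ->
    0 < r -> r < r0 ->
    ball (x0 + (r0 - r) *: a0) ((r0 - r) * e) x ->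
  homothet A x r `<=` homothet A° x0 r0.
Proof.
move=> cA aeA r_gt0 rr0; have r0_gt0 := lt_trans r_gt0 rr0.
have k0 : 0 < r0 - r by rewrite subr_gt0.
rewrite -ball_normE /= => xP _ [a Aa <-].
pose a' := (r0 - r)^-1 *: (x - x0).
have a'P : ball a0 e a'.
  rewrite -ball_normE/= -(ltr_pM2l k0) -[X in X * `|_|](gtr0_norm k0) -normrZ.
  by rewrite scalerBr scalerKV ?gt_eqF// opprB addrA [_ *: _ + _]addrC.
rewrite homothetE ?gt_eqF//=.
set z := r0^-1 *: (x + r *: a - x0).
pose t := (r0 - r) / r0.
have t_gt0 : 0 < t by rewrite divr_gt0.
have zE : z = t *: a' + (1 - t) *: a.
  rewrite /z /t /a' scalerA mulrAC divff ?gt_eqF// mul1r addrAC.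
  rewrite scalerDr scalerA.
  by congr (_ + _ *: _); field; rewrite gt_eqF.
pose g w := a' + t^-1 *: (w - z).
apply: (@filterS _ _ _ (g @^-1` ball a0 e)).
  move=> w gw; rewrite (_ : w = t *: g w + (1 - t) *: a).
    apply: convex_set_conv cA (aeA _ gw) Aa (ltW t_gt0) _.
    by rewrite /t ler_pdivrMr// mul1r lerBlDr lerDl ltW.
  by rewrite /g scalerDr scalerKV ?gt_eqF// zE addrAC subrKC.
apply: open_nbhs_nbhs; split; last by rewrite /= /g subrr scaler0 addr0.
apply: open_comp; last exact: ball_open.
by move=> w _; exact: continuous_affine.
Qed.

Section spacing_gt.
Variables A K : set 'rV[R]_d.
Hypothesis d_gt0 : (0 < d)%N.
Hypothesis K_bounded : bounded_set K.
Hypothesis A_convex : convex_set (A : set (convex_lmodType 'rV[R]_d)).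
Variables (a0 : 'rV[R]_d) (e : R).
Hypothesis e_gt0 : 0 < e.
Hypothesis aeA : ball a0 e `<=` A.

(** A homothet of ratio r contains two points at distance r e / 2 in every
coordinate, which the diameter of K bounds; with d = 0 there is no such pair. *)
Lemma has_ubound_spacing pts :
  has_ubound [set r : R | 0 < r /\ exists x, homothet A x r `<=` K `\` pts].
Proof.
have [M M0 KM] := bounded_set_lt K_bounded.
exists (M * 4 / e) => r [r0 [x xrK]].
pose v : 'rV[R]_d := const_mx (e / 2).
have e2 : 0 < e / 2 by rewrite divr_gt0.
have ee : e / 2 < e by rewrite ltr_pdivrMr// ltr_pMr// ltr1n.
have vE (i : 'I_d) : v ord0 i = e / 2 by rewrite mxE.
have Aa0 : A a0 by apply: aeA; exact: ballxx.
have Aav : A (a0 + v).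
  apply/aeA/ball_rVP => // i.
  by rewrite !mxE opprD addNKr normrN gtr0_norm.
have xrKM a : A a -> `|x + r *: a| < M.
  by move=> Aa; apply: KM; have [] : (K `\` pts) (x + r *: a);
    [apply: xrK; exists a|].
have h1 := xrKM _ Aa0; have h2 := xrKM _ Aav.
have : `|r *: v| < M + M.
  rewrite (_ : r *: v = (x + r *: (a0 + v)) - (x + r *: a0)).
    by rewrite (le_lt_trans (ler_normB _ _))// ltrD.
  by rewrite scalerDr opprD addrACA subrr add0r addrAC subrr add0r.
rewrite -[r *: v]opprK normrN -[- (r *: v)]add0r => rvM.
have /ball_rVP : ball 0 (M + M) (r *: v) by rewrite -ball_normE.
move=> /(_ _ (Ordinal d_gt0)); rewrite addr_gt0// !mxE sub0r normrN => /(_ isT).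
rewrite gtr0_norm ?mulr_gt0// => h; rewrite ler_pdivlMr//.
by lra.
Qed.

Lemma lt_max_spacingP pts s : 0 <= s ->
  (s < max_spacing A K pts) <->
  exists r, s < r /\ exists x, homothet A x r `<=` K `\` pts.
Proof.
move=> s0; split=> [sD|[r [sr [x xr]]]].
  have [E0|/set0P E0] := eqVneq [set r : R | 0 < r /\
      exists x, homothet A x r `<=` K `\` pts] set0.
    by move: sD; rewrite /max_spacing E0 sup0 ltNge s0.
  by have [r [r0 xr] sr] := sup_gt E0 sD; exists r.
apply: (lt_le_trans sr); apply: ub_le_sup; first exact: has_ubound_spacing.
by split; [exact: le_lt_trans sr|exists x].
Qed.

(** It is enough that the points miss the open homothet: slightly smaller
homothets of A itself fit inside it. *)
Lemma lt_max_spacing_avoid pts s x r : 0 <= s -> s < r ->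
  homothet A x r `<=` K -> homothet A° x r `&` pts = set0 ->
  s < max_spacing A K pts.
Proof.
move=> s0 sr xrK xr0; apply/lt_max_spacingP => //.
have [r' /andP[sr' r'r]] : exists r', s < r' < r.
  by exists ((s + r) / 2); rewrite !(midf_lt sr).
exists r'; split=> //; exists (x + (r - r') *: a0).
apply: subset_trans (homothet_shrink A_convex aeA (le_lt_trans s0 sr') r'r _) _.
  by apply: ballxx; rewrite mulr_gt0// subr_gt0.
move=> y xry; split.
  exact/xrK/(homothetS (@interior_subset _ A) xry).
by move=> py; have : (homothet A° x r `&` pts) y by []; rewrite xr0.
Qed.

(** The homothets range over a countable family, and the condition on the points
is membership of each of them in a closed set: this is what makes the event
measurable whatever K and A are. *)
Lemma lt_max_spacing_ratP pts s : 0 <= s ->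
  (s < max_spacing A K pts) <->
  exists p : 'rV[rat]_d * rat, [/\ s < ratr p.2,
    homothet A (map_mx ratr p.1) (ratr p.2) `<=` K &
    homothet A° (map_mx ratr p.1) (ratr p.2) `&` pts = set0].
Proof.
move=> s0; split=> [/lt_max_spacingP -/(_ s0) [r0 [sr0 [x0 xr0]]]|]; last first.
  by move=> [p [sp pK p0]]; exact: lt_max_spacing_avoid pK p0.
have [r] := rat_in_itvoo sr0; rewrite in_itv/= => /andP[sr rr0].
have del0 : 0 < (r0 - ratr r) * e by rewrite mulr_gt0// subr_gt0.
have [q xq] := rat_row_dense (x0 + (r0 - ratr r) *: a0) del0.
have sub : homothet A (map_mx ratr q) (ratr r) `<=` K `\` pts.
  have r_gt0 := le_lt_trans s0 sr.
  apply: subset_trans (homothet_shrink A_convex aeA r_gt0 rr0 xq) _.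
  apply: subset_trans xr0; apply: homothetS; exact: interior_subset.
exists (q, r); split=> //=; first by move=> y /sub[].
apply/seteqP; split=> // y [xry py].
by have [] : (K `\` pts) y by exact/sub/(homothetS (@interior_subset _ A) xry).
Qed.

End spacing_gt.
End homothets.

(** * The second moment method *)

Section second_moment.
Context (dO : measure_display) (Omega : measurableType dO) (R : realType)
  (P : probability Omega R).

Lemma integral_step (I : finType) (a : I -> R) (A : I -> set Omega) :
  (forall i, 0 <= a i) -> (forall i, measurable (A i)) ->
  (\int[P]_w (\sum_i a i * \1_(A i) w)%R%:E)%E =
  (\sum_i a i * fine (P (A i)))%:E.
Proof.
move=> a0 mA; under eq_integral do rewrite -sumEFin.
rewrite ge0_integral_sum//.
- rewrite -sumEFin; apply: eq_bigr => i _.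
  rewrite (integralZl_indic measurableT (fun=> A i))// ?integral_indic//.
    by rewrite setIT EFinM fineK// fin_num_measure.
  by rewrite ltNge a0.
- move=> i; apply/measurable_EFinP.
  by apply: measurable_funM => //; exact: measurable_indic.
- by move=> i w _; rewrite lee_fin mulr_ge0.
Qed.

Lemma le_step_measure (I J : finType) (a : I -> R) (b : J -> R)
    (A : I -> set Omega) (B : J -> set Omega) :
  (forall i, 0 <= a i) -> (forall i, measurable (A i)) ->
  (forall j, 0 <= b j) -> (forall j, measurable (B j)) ->
  (forall w, \sum_i a i * \1_(A i) w <= \sum_j b j * \1_(B j) w) ->
  \sum_i a i * fine (P (A i)) <= \sum_j b j * fine (P (B j)).
Proof.
have step_mf (H : finType) (k : H -> R) (C : H -> set Omega) :
    (forall h, measurable (C h)) ->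
    measurable_fun setT (fun w => (\sum_h k h * \1_(C h) w)%:E).
  move=> mC; apply/measurable_EFinP; apply: measurable_sum => h.
  by apply: measurable_funM => //; exact: measurable_indic.
move=> a0 mA b0 mB AB; rewrite -lee_fin -!integral_step//.
apply: (ge0_le_integral _ measurableT); [|exact: step_mf|exact: step_mf|];
  last by move=> w _; rewrite lee_fin.
by move=> w _; rewrite lee_fin sumr_ge0// => i _; rewrite mulr_ge0.
Qed.

Lemma sum_option (I : finType) (F : option I -> R) :
  \sum_o F o = F None + \sum_i F (Some i).
Proof.
rewrite (bigD1 None)//=; congr (_ + _).
rewrite (reindex_omap Some id)/=; last by case.
by apply: eq_bigl => i; rewrite eqxx.
Qed.

(** With z the number of events E i that occur and mu its mean, expand
(z - mu)^2 >= 0 into 2 mu z <= z^2 + mu^2, which can be strengthened by adding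
mu^2 on the left where z = 0.  Both sides are then combinations of indicator
functions with nonnegative coefficients, indexed by option types whose [None]
carries the constant term, and integrating gives
mu^2 P(z = 0) + 2 mu^2 <= (mu + mu^2) + mu^2. *)
Lemma second_moment (I : finType) (E : I -> set Omega) :
  (forall i, measurable (E i)) ->
  (forall i j, i != j ->
    fine (P (E i `&` E j)) <= fine (P (E i)) * fine (P (E j))) ->
  (\sum_i fine (P (E i))) * fine (P (~` \bigcup_i E i)) <= 1.
Proof.
move=> mE EE; set mu := \sum_i _; set N := ~` _.
have mu0 : 0 <= mu by apply: sumr_ge0 => i _; rewrite fine_ge0.
have mN : measurable N.
  by apply: measurableC; apply: countable_bigcupT_measurable.
have := @le_step_measure (option I) (option (I * I))
  (fun o => if o is Some _ then 2 * mu else mu ^+ 2)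
  (fun o => if o is Some _ then 1 else mu ^+ 2)
  (fun o => if o is Some i then E i else N)
  (fun o => if o is Some p then E p.1 `&` E p.2 else setT).
rewrite !sum_option /= -mulr_sumr -/mu probability_setT /= mulr1.
under [X in _ -> _ -> _ -> _ -> _ -> _ <= _ + X]eq_bigr do rewrite mul1r.
have sumle : \sum_p fine (P (E p.1 `&` E p.2)) <= mu + mu ^+ 2.
  rewrite -(pair_bigA _ (fun i j => fine (P (E i `&` E j))))/=.
  rewrite [X in _ + X]expr2 {2}/mu mulr_suml -big_split/=.
  apply: ler_sum => i _; rewrite (bigD1 i)//= setIid lerD2l.
  apply: (@le_trans _ _ (\sum_(j | j != i) fine (P (E i)) * fine (P (E j)))).
    by apply: ler_sum => j ji; apply: EE; rewrite eq_sym.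
  rewrite -mulr_sumr ler_wpM2l ?fine_ge0// /mu [leRHS](bigD1 i)//=.
  by rewrite lerDr fine_ge0.
have [->|mu_neq0] := eqVneq mu 0; first by rewrite mul0r.
have mu_gt0 : 0 < mu by rewrite lt_neqAle eq_sym mu_neq0.
move=> H; rewrite -(ler_pM2l mu_gt0) mulr1 mulrA -expr2.
suff : mu ^+ 2 * fine (P N) + 2 * mu * mu <= mu ^+ 2 + (mu + mu ^+ 2) by nra.
apply: le_trans (H _ _ _ _ _) _ => {H}.
- by case=> [_|]; rewrite ?mulr_ge0 ?exprn_ge0.
- by case.
- by case=> [_|]; rewrite ?exprn_ge0.
- by case=> // p; exact: measurableI.
- move=> w; rewrite !sum_option/=.
  set z := \sum_i \1_(E i) w : R.
  rewrite -mulr_sumr -/z.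
  have -> : \sum_p 1 * \1_(E p.1 `&` E p.2) w = z ^+ 2 :> R.
    under eq_bigr do rewrite mul1r indicI.
    rewrite -(pair_bigA _ (fun i j => \1_(E i) w * \1_(E j) w))/=.
    rewrite expr2 {1}/z mulr_suml.
    by apply: eq_bigr => i _; rewrite mulr_sumr.
  rewrite indicT mulr1.
  have [Nw|Nw] := pselect (N w).
    have -> : z = 0.
      rewrite /z big1// => i _; rewrite indicE memNset// => Ei; apply: Nw.
      by exists i.
    by rewrite indicE mem_set// expr0n/= mulr1 mulr0 !addr0.
  rewrite indicE memNset// mulr0 add0r -subr_ge0.
  by rewrite (_ : _ - _ = (z - mu) ^+ 2) ?sqr_ge0//; ring.
- by rewrite lerD2l.
Qed.

End second_moment.

(** * Cells missed by independent points *)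

Section iid_points.
Context (dO : measure_display) (Omega : measurableType dO) (R : realType)
  (P : probability Omega R) (d : nat) (X : nat -> {RV P >-> 'rV[R]_d}).

Lemma avoidE n (B : set 'rV[R]_d) :
  [set w | B `&` [set X i w | i in `I_n] = set0] =
  \bigcap_(i in `I_n) X i @^-1` ~` B.
Proof.
apply/seteqP; split=> w /= h; last first.
  by apply/seteqP; split=> // y [yB [i ni iy]]; apply: (h i ni); rewrite /= iy.
move=> i ni Bi.
have : (B `&` [set X i w | i in `I_n]) (X i w) by split => //; exists i.
by rewrite h.
Qed.

Lemma measurable_avoid n (B : set 'rV[R]_d) : measurable B ->
  measurable [set w | B `&` [set X i w | i in `I_n] = set0].
Proof.
move=> mB; rewrite avoidE; apply: fin_bigcap_measurable => // i _.
by apply: measurable_funPTI; exact: measurableC.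
Qed.

Lemma iid_avoid n (B : set 'rV[R]_d) : iid X -> measurable B ->
  P [set w | B `&` [set X i w | i in `I_n] = set0] =
  ((1 - fine (P (X 0%N @^-1` B))) ^+ n)%:E.
Proof.
move=> [indX idX] mB; rewrite avoidE.
have := indX [fset i in iota 0 n]%fset (fun=> ~` B) (fun=> measurableC mB).
rewrite (_ : [set` _] = `I_n); last first.
  by apply/seteqP; split=> i /=; rewrite inE/= mem_iota add0n.
move=> ->; rewrite (eq_bigr (fun=> (1 - fine (P (X 0%N @^-1` B)))%:E)).
  rewrite prodEFin big_const_seq count_predT.
  rewrite (_ : size _ = n) ?iter_mulr_1//.
  rewrite -[LHS]/(#|` [fset i in iota 0 n]%fset|) card_fseq.
  by rewrite undup_id ?iota_uniq// size_iota.
move=> i _; have := idX i 0%N (~` B) (measurableC mB).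
rewrite /distribution /pushforward/= => ->.
rewrite preimage_setC probability_setC ?EFinB ?fineK ?fin_num_measure//.
  by apply: measurable_funPTI.
by apply: measurable_funPTI.
Qed.
End iid_points.

Section empty_cell.
Context (dO : measure_display) (Omega : measurableType dO) (R : realType)
  (P : probability Omega R) (d : nat) (X : nat -> {RV P >-> 'rV[R]_d}).

(** The negative correlation needed by [second_moment] is that
(1 - qi - qj)^n is at most ((1 - qi) (1 - qj))^n for disjoint cells. *)
Lemma empty_cell_bound (I : finType) (C : I -> set 'rV[R]_d) (p : R) n :
  iid X -> (forall i, measurable (C i)) ->
  (forall i j, i != j -> C i `&` C j = set0) ->
  0 <= p <= 1 -> (forall i, (P (X 0%N @^-1` C i) <= p%:E)%E) ->
  #|I|%:R * (1 - p) ^+ n *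
    fine (P (~` \bigcup_i
      [set w | C i `&` [set X j w | j in `I_n] = set0])) <= 1.
Proof.
move=> iidX mC dC /andP[p0 p1] Cp.
pose E i := [set w | C i `&` [set X j w | j in `I_n] = set0].
have mX B : measurable B -> measurable (X 0%N @^-1` B).
  by move=> mB; exact: measurable_funPTI.
have fine_le1 B : measurable B -> fine (P (X 0%N @^-1` B)) <= 1.
  move=> mB; rewrite -lee_fin fineK ?fin_num_measure//; last exact: mX.
  by apply: probability_le1; exact: mX.
pose q i := fine (P (X 0%N @^-1` C i)).
have PE i : fine (P (E i)) = (1 - q i) ^+ n by rewrite /E iid_avoid.
apply: le_trans (@second_moment _ _ _ P I E _ _).
- rewrite ler_wpM2r ?fine_ge0//.
  apply: (@le_trans _ _ (\sum_(i : I) (1 - p) ^+ n)).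
    by rewrite sumr_const -[leRHS]mulr_natl.
  apply: ler_sum => i _; rewrite PE lerXn2r ?nnegrE ?subr_ge0//.
    exact: fine_le1.
  by rewrite lerD2l lerN2 -lee_fin fineK ?fin_num_measure//; exact: mX.
- by move=> i; exact: measurable_avoid.
- move=> i j ij; rewrite !PE.
  have -> : E i `&` E j =
      [set w | (C i `|` C j) `&` [set X j w | j in `I_n] = set0].
    by apply/seteqP; split=> w /=; rewrite setIUl setU_eq0.
  rewrite iid_avoid//; last exact: measurableU.
  have := fine_le1 _ (measurableU _ _ (mC i) (mC j)).
  have -> : fine (P (X 0%N @^-1` (C i `|` C j))) = q i + q j.
    rewrite preimage_setU measureU//=; last 3 first.
    + exact: mX.
    + exact: mX.
    + by rewrite -preimage_setI dC// preimage_set0.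
    by rewrite fineD ?fin_num_measure//; exact: mX.
  move=> qij; have := fine_le1 _ (mC i); have := fine_le1 _ (mC j).
  rewrite -/(q i) -/(q j) => qi qj.
  have : 0 <= q i * q j by rewrite mulr_ge0 ?fine_ge0.
  rewrite -exprMn => qq; rewrite lerXn2r ?nnegrE ?mulr_ge0 ?subr_ge0//.
  by nra.
Qed.
End empty_cell.

(** * A grid of disjoint cells in a ball *)

Section cells.
Context (R : realType) (d : nat).
Implicit Types (c x y : 'rV[R]_d) (s r rho M : R).

Lemma box_sub_euclidean_ball c r y : (0 < d)%N -> 0 <= r ->
  (forall i, `|y ord0 i - c ord0 i| <= r / d%:R) -> euclidean_ball c r y.
Proof.
move=> d0 r0 yc; rewrite /euclidean_ball/= -[leRHS](ger0_norm r0) -sqrtr_sqr.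
rewrite ler_wsqrtr//.
have rd : r / d%:R <= r by rewrite ler_piMr// invf_le1 ?ler1n ?ltr0n.
apply: (@le_trans _ _ (\sum_(i < d) (r * (r / d%:R)))).
  apply: ler_sum => i _; rewrite -real_normK ?num_real// expr2.
  by rewrite ler_pM// (le_trans (yc i)).
rewrite sumr_const card_ord -[leLHS]mulr_natr -mulrA.
by rewrite divfK ?expr2// pnatr_eq0 -lt0n.
Qed.

Definition grid c s m (k : {ffun 'I_d -> 'I_m}) : 'rV[R]_d :=
  \row_i (c ord0 i + s * (k i)%:R).

Lemma grid_homothet (A : set 'rV[R]_d) c s M m k y :
  0 < M -> 0 < s -> (forall a, A a -> `|a| < M) ->
  homothet A (grid c (2 * M * s) k) s y ->
  forall i : 'I_d, `|y ord0 i - c ord0 i - 2 * M * s * (k i : 'I_m)%:R| < M * s.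
Proof.
move=> M0 s0 AM [a /AM aM <-] i; rewrite !mxE.
rewrite (_ : _ - _ - _ = s * a ord0 i); last by ring.
rewrite normrM gtr0_norm// mulrC ltr_pM2r//.
have /ball_rVP : ball 0 M a by rewrite -ball_normE/= sub0r normrN.
by move=> /(_ M0 i); rewrite mxE sub0r normrN.
Qed.

Lemma grid_in_box (A : set 'rV[R]_d) c s M m rho (k : {ffun 'I_d -> 'I_m}) y :
  0 < M -> 0 < s -> (forall a, A a -> `|a| < M) -> 2 * M * s * m%:R <= rho ->
  homothet A (grid c (2 * M * s) k) s y ->
  forall i, `|y ord0 i - c ord0 i| <= rho.
Proof.
move=> M0 s0 AM mrho yk i; have := grid_homothet M0 s0 AM yk i.
set t := _ - c _ _; have Ms : 0 < M * s by rewrite mulr_gt0.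
have ki0 : 0 <= (k i)%:R :> R by [].
have kim : (k i)%:R + 1 <= m%:R :> R by rewrite natr1 ler_nat.
by rewrite ltr_norml ler_norml => /andP[h1 h2]; apply/andP; split; nra.
Qed.

Lemma grid_disjoint (A : set 'rV[R]_d) c s M m (k l : {ffun 'I_d -> 'I_m}) :
  0 < M -> 0 < s -> (forall a, A a -> `|a| < M) -> k != l ->
  homothet A (grid c (2 * M * s) k) s `&` homothet A (grid c (2 * M * s) l) s =
  set0.
Proof.
move=> M0 s0 AM kl; apply/seteqP; split=> // y [yk yl].
case/negP: kl; apply/eqP/ffunP => i; apply/val_inj/eqP.
have := grid_homothet M0 s0 AM yk i; have := grid_homothet M0 s0 AM yl i.
set t := _ - c _ _; have Ms : 0 < M * s by rewrite mulr_gt0.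
rewrite !ltr_norml => /andP[h1 h2] /andP[h3 h4].
have [kl|lk|//] := ltngtP (k i) (l i).
  have : (k i)%:R + 1 <= (l i)%:R :> R by rewrite natr1 ler_nat.
  by nra.
have : (l i)%:R + 1 <= (k i)%:R :> R by rewrite natr1 ler_nat.
by nra.
Qed.

End cells.

(** * Asymptotic estimates *)

Section asymptotics.
Context {R : realType}.
Implicit Types a e C : R.

Lemma near_ln_nat (Q : R -> Prop) : (\forall L \near +oo, Q L) ->
  \forall n \near \oo, Q (ln n%:R).
Proof.
move=> [B [_ BQ]]; exists (Num.truncn (expR B)).+1 => // n /= nB; apply: BQ.
have nR : expR B < n%:R by apply: lt_le_trans (truncnS_gt _) _; rewrite ler_nat.
rewrite -[ltLHS]expRK ltr_ln// posrE ?expR_gt0//.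
exact: lt_trans (expR_gt0 _) nR.
Qed.

Lemma le_near_pinfty_mulN a C : 0 < a -> \forall L \near +oo, C <= a * L.
Proof.
move=> a0; by near=> L; rewrite mulrC -ler_pdivrMr//; near: L.
Unshelve. all: by end_near. Qed.

Lemma near_mul_expRN e : 0 < e -> \forall L \near +oo, L * expR (- L) <= e.
Proof.
move=> e0; near=> L.
have L0 : 0 < L by near: L; exact: nbhs_pinfty_gt.
have h : L ^+ 2 / 4 <= expR L.
  have e2 : L / 2 <= expR (L / 2).
    by apply: le_trans (expR_ge1Dx _); rewrite lerDr.
  rewrite (_ : expR L = expR (L / 2) ^+ 2).
    rewrite (_ : L ^+ 2 / 4 = (L / 2) ^+ 2); last by field.
    by rewrite lerXn2r ?nnegrE ?expR_ge0// divr_ge0// ltW.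
  by rewrite -expRM_natl; congr expR; field.
rewrite expRN ler_pdivrMr ?expR_gt0//.
have eL : 4 <= e * L by near: L; exact: le_near_pinfty_mulN.
apply: le_trans (ler_wpM2l (ltW e0) h).
by nra.
Unshelve. all: by end_near. Qed.

Lemma near_ln_le e C : 0 < e -> 0 <= C ->
  \forall L \near +oo, C * ln L <= e * L.
Proof.
move=> e0 C0; near=> L.
have L1 : 1 <= L by near: L; exact: nbhs_pinfty_ge.
have L0 : 0 < L := lt_le_trans ltr01 L1.
(* ln L = 2 ln y <= 2 y is already sublinear. *)
pose y := Num.sqrt L.
have y0 : 0 < y by rewrite sqrtr_gt0.
have Ly : L = y ^+ 2 by rewrite sqr_sqrtr// ltW.
have lny : ln L <= 2 * y.
  rewrite Ly lnXn// -[leLHS]mulr_natl ler_pM2l//; exact/ltW/ln_sublinear.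
have eL : (2 * C) ^+ 2 <= e ^+ 2 * L.
  by near: L; apply: le_near_pinfty_mulN; rewrite exprn_gt0.
have ey : 2 * C <= e * y.
  rewrite -(@ler_pXn2r _ 2) ?nnegrE ?mulr_ge0 ?(ltW e0) ?(ltW y0)//.
  by rewrite [leRHS]exprMn -Ly.
apply: (@le_trans _ _ (C * (2 * y))); first exact: ler_wpM2l.
rewrite Ly; nra.
Unshelve. all: by end_near. Qed.

Lemma expRN_le_1B (u : R) : u < 1 -> expR (- (u / (1 - u))) <= 1 - u.
Proof.
move=> u1; have u10 : 0 < 1 - u by rewrite subr_gt0.
rewrite expRN -[leRHS]invrK lef_pV2 ?posrE ?expR_gt0 ?invr_gt0//.
apply: le_trans (expR_ge1Dx _); rewrite le_eqVlt; apply/orP; left; apply/eqP.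
by field; rewrite gt_eqF.
Qed.

Lemma exists_root (d : nat) (t : R) : (0 < d)%N -> 0 <= t ->
  exists2 s, 0 <= s & s ^+ d = t.
Proof.
move=> d0 t0; exists (t `^ d%:R^-1); first exact: powR_ge0.
rewrite -powR_mulrn ?powR_ge0// -powRrM mulVf ?powRr1//.
by rewrite pnatr_eq0 -lt0n.
Qed.

Lemma exists_nat_half (x : R) : 1 <= x ->
  exists m : nat, x / 2 <= m%:R /\ m%:R <= x.
Proof.
move=> x1; exists (Num.truncn x); rewrite truncn_le (le_trans _ x1)//.
have := truncnS_gt x; have : (1 <= Num.truncn x)%N by rewrite truncn_gt0.
by rewrite -(ler1n R) -[(Num.truncn x).+1%:R]natr1 => m1 mx; split => //; lra.
Qed.

(** With n = exp L and cells of volume t = (1 + e) L / n, the number of cells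
times the probability that a given one is empty is, up to a constant, at least
(1 - (1 - e) t)^n / t; this quotient is at least a constant times
exp (e^2 L / 4).  The exponent (1 - e^2) L of the ideal bound is weakened to
(1 - e^2 / 2) L to pass from 1 - u to an exponential, and half of the remaining
gain absorbs the factor L of t. *)
Lemma void_probability_rate (e L : R) n :
  n%:R = expR L -> 0 < e -> e <= 1 / 2 -> 0 < L ->
  let t := (1 + e) * (L * expR (- L)) in
  (1 - e) * t <= e ^+ 2 / 2 ->
  e ^+ 2 / 4 * t <=
    (1 + e) * expR (- (e ^+ 2 / 4 * L)) * (1 - (1 - e) * t) ^+ n.
Proof.
move=> nL e0 e12 L0 t; set u := (1 - e) * t => ue.
have e2 : 0 < e ^+ 2 by rewrite exprn_gt0.
have u1 : u < 1 by nra.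
have u10 : 0 < 1 - u by rewrite subr_gt0.
have h1 : expR (- ((1 - e ^+ 2 / 2) * L)) <= (1 - u) ^+ n.
  apply: (@le_trans _ _ (expR (- (u / (1 - u))) ^+ n)); last first.
    by rewrite lerXn2r ?nnegrE ?expR_ge0 ?(ltW u10)//; exact: expRN_le_1B.
  rewrite -expRM_natl nL ler_expR mulrN lerN2.
  rewrite mulrA ler_pdivrMr//.
  have -> : expR L * u = (1 - e ^+ 2) * L.
    by rewrite /u /t expRN; field; rewrite gt_eqF ?expR_gt0.
  rewrite mulrAC ler_pM2r//.
  have e2_le1 : e ^+ 2 <= 1 by rewrite expr_le1 ?(ltW e0)//; lra.
  have : 0 <= (1 - e ^+ 2 / 2) * (e ^+ 2 / 2 - u) by rewrite mulr_ge0; lra.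
  have : 0 <= (e ^+ 2 / 2) ^+ 2 by rewrite sqr_ge0.
  move: (e ^+ 2) => E; lra.
apply: (@le_trans _ _ ((1 + e) * expR (- (e ^+ 2 / 4 * L)) *
                       expR (- ((1 - e ^+ 2 / 2) * L)))).
  rewrite /t mulrCA -[leRHS]mulrA ler_pM2l ?addr_gt0// -expRD mulrA.
  rewrite (_ : - _ + _ = - L + e ^+ 2 / 4 * L); last by field.
  rewrite expRD mulrC ler_pM2l ?expR_gt0//.
  rewrite mulrC.
  by apply: le_trans (expR_ge1Dx _); rewrite lerDr.
by rewrite ler_wpM2l// mulr_ge0 ?expR_ge0// addr_ge0// ltW.
Qed.

End asymptotics.

(** * The maximum spacing of random points *)

Section max_spacing_probability.
Context (R : realType) (d : nat) (A K : set 'rV[R]_d)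
  (dO : measure_display) (Omega : measurableType dO)
  (P : probability Omega R) (X : nat -> {RV P >-> 'rV[R]_d}).
Hypothesis d_gt0 : (0 < d)%N.
Hypothesis K_bounded : bounded_set K.
Hypothesis A_convex : convex_set (A : set (convex_lmodType 'rV[R]_d)).
Hypothesis A_interior : A° !=set0.

Let A_ball : exists a0 e, 0 < e /\ ball a0 e `<=` A.
Proof.
have [a0 /nbhs_ballP[e e0 aeA]] := A_interior.
by exists a0, e.
Qed.

Lemma measurable_homothet x s : 0 < s ->
  (measurable (homothet A° x s) : Prop).
Proof.
move=> s0; apply: sub_sigma_algebra; apply: open_homothet => //.
exact: open_interior.
Qed.

Lemma max_spacing_ge0 (pts : set 'rV[R]_d) : 0 <= max_spacing A K pts.
Proof.
rewrite /max_spacing; set E := mkset _.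
have [->|/set0P[r Er]] := eqVneq E set0; first by rewrite sup0.
have [a0 [e [e0 aeA]]] := A_ball.
have r0 : 0 <= r by case: Er => /ltW.
apply: (le_trans r0); apply: ub_le_sup Er.
exact: (has_ubound_spacing d_gt0 K_bounded e0 aeA).
Qed.

Lemma measurable_lt_max_spacing n s : 0 <= s ->
  measurable [set w | s < max_spacing A K [set X i w | i in `I_n]].
Proof.
move=> s0; have [a0 [e [e0 aeA]]] := A_ball.
pose good := [set p : 'rV[rat]_d * rat | s < ratr p.2 /\
  homothet A (map_mx ratr p.1) (ratr p.2) `<=` K].
rewrite (_ : mkset _ = \bigcup_(p in good)
    [set w | homothet A° (map_mx ratr p.1) (ratr p.2) `&`
       [set X i w | i in `I_n] = set0]).
  rewrite bigcup_mkcond; apply: countable_bigcupT_measurable => // p.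
  case: ifPn => // /set_mem[sp _]; apply: measurable_avoid.
  by apply: measurable_homothet; exact: le_lt_trans sp.
apply/seteqP; split=> w /=.
  move=> /(lt_max_spacing_ratP d_gt0 K_bounded A_convex e0 aeA _ s0).
  by move=> [p [sp pK p0]]; exists p.
move=> [p [sp pK] p0].
by apply/(lt_max_spacing_ratP d_gt0 K_bounded A_convex e0 aeA _ s0); exists p.
Qed.

(** M bounds A in the sup norm, so that cells whose centres lie on a grid of
mesh 2 M s are disjoint; m of them fit along each axis of the cube of half-side
r / d, which is contained in the Euclidean ball of radius r.  The ratio s
exceeds s0 because an open homothet of ratio s only yields spacings smaller
than s. *)
Lemma small_max_spacing_bound (f : 'rV[R]_d -> R) c r q M s0 s m n :
  iid X -> has_lebesgue_density (X 0%N) f -> lebesgue_rV A = 1%E ->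
  (forall a, A a -> `|a| < M) -> 0 < M -> 0 <= r ->
  euclidean_ball c r `<=` K ->
  (forall x, euclidean_ball c r x -> f x <= q) ->
  0 <= q -> 0 <= s0 -> s0 < s -> q * s ^+ d <= 1 ->
  2 * M * s * m%:R <= r / d%:R ->
  (m%:R) ^+ d * (1 - q * s ^+ d) ^+ n *
    (1 - fine (P [set w | s0 < max_spacing A K [set X i w | i in `I_n]])) <= 1.
Proof.
move=> iidX fX A1 AM M0 r0 cK fq q0 s00 s0s qs1 mr.
have s_gt0 : 0 < s := le_lt_trans s00 s0s.
have [a0 [e [e0 aeA]]] := A_ball.
pose C (k : {ffun 'I_d -> 'I_m}) := homothet A° (grid c (2 * M * s) k) s.
have AM' a : A° a -> `|a| < M by move=> /interior_subset; exact: AM.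
have boxS (k : {ffun 'I_d -> 'I_m}) :
    homothet A (grid c (2 * M * s) k) s `<=` euclidean_ball c r.
  move=> y yk; apply: box_sub_euclidean_ball => // i.
  exact: grid_in_box M0 s_gt0 AM mr yk i.
have mC k : measurable (C k) by exact: measurable_homothet.
set D := [set w | _].
have mD : measurable D by exact: measurable_lt_max_spacing.
have qs0 : 0 <= q * s ^+ d <= 1 by rewrite qs1 mulr_ge0// exprn_ge0// ltW.
have := @empty_cell_bound _ _ _ P _ X _ C (q * s ^+ d) n iidX mC _ qs0 _.
rewrite card_ffun !card_ord natrX => H.
apply: le_trans (H _ _) => {H}.
- apply: ler_wpM2l.
    by rewrite mulr_ge0 ?exprn_ge0// subr_ge0; case/andP: qs0.
  have -> : 1 - fine (P D) = fine (P (~` D)).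
    by rewrite probability_setC// fineB ?fin_num_measure.
  have mU : measurable (~` \bigcup_k
      [set w | C k `&` [set X j w | j in `I_n] = set0]).
    apply: measurableC; apply: countable_bigcupT_measurable => // k.
    exact: measurable_avoid.
  have mDC := measurableC mD.
  rewrite fine_le ?fin_num_measure// le_measure ?inE//.
  apply: subsetC => w [k _ Ek].
  apply: (lt_max_spacing_avoid d_gt0 K_bounded A_convex e0 aeA s00 s0s _ Ek).
  exact: subset_trans (boxS k) cK.
- by move=> k l kl; exact: grid_disjoint M0 s_gt0 AM' kl.
- move=> k.
  have oC : open (C k) by apply: open_homothet => //; exact: open_interior.
  apply: le_trans (density_le fX oC q0 _) _.
    by move=> y /(homothetS (@interior_subset _ A)) yk; exact/fq/(boxS k).
  rewrite EFinM lee_wpmul2l ?lee_fin//.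
  apply: le_trans (lebesgue_rV_homothet _ _ s_gt0) _.
  rewrite -[leRHS]mule1 lee_wpmul2l//; first by rewrite lee_fin exprn_ge0// ltW.
by rewrite -A1; apply: le_outer_measure; exact: interior_subset.
Qed.

(** The bound (1 + e) (log n) / n eventually exceeds (log n + O(log log n)) / n,
which leaves room for the lower order terms of extreme value theory. *)
Lemma lt_max_spacing_volume_whp (f : 'rV[R]_d -> R) c r e (thr : nat -> R) :
  iid X -> has_lebesgue_density (X 0%N) f -> bounded_set A ->
  lebesgue_rV A = 1%E -> 0 < r -> euclidean_ball c r `<=` K ->
  0 < e -> e <= 1 / 2 ->
  (forall x, euclidean_ball c r x -> f x <= 1 - e) ->
  (\forall n \near \oo, 0 <= thr n /\ thr n < (1 + e) * (ln n%:R / n%:R)) ->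
  P [set w | thr n < max_spacing_volume A K (X ^~ w) n] @[n --> \oo] --> 1%E.
Proof.
move=> iidX fX A_bounded A1 r_gt0 cK e0 e12 fq thrP.
have [M M0 AM] := bounded_set_lt A_bounded.
have e2 : 0 < e ^+ 2 by rewrite exprn_gt0.
have e2_le1 : e ^+ 2 <= 1 by rewrite expr_le1 ?(ltW e0)//; lra.
have q0 : 0 <= 1 - e by lra.
pose rho := r / d%:R.
have rho0 : 0 < rho by rewrite divr_gt0// ltr0n.
have rM0 : 0 < rho / (2 * M) by rewrite divr_gt0// mulr_gt0.
pose kappa := (rho / (2 * M) / 2) ^+ d.
have kappa0 : 0 < kappa by rewrite exprn_gt0// divr_gt0.
pose E n := [set w | thr n < max_spacing_volume A K (X ^~ w) n].
suff EP delta : 0 < delta -> \forall n \near \oo,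
    measurable (E n) /\ 1 - fine (P (E n)) <= delta.
  apply/fine_cvgP; split.
    near=> n; apply: fin_num_measure.
    suff [] : measurable (E n) /\ 1 - fine (P (E n)) <= 1 by [].
    by near: n; exact: EP.
  apply/cvgrPdist_le => delta delta0; near=> n => /=.
  have [mE PE] : measurable (E n) /\ 1 - fine (P (E n)) <= delta.
    by near: n; exact: EP.
  rewrite ger0_norm// subr_ge0 -lee_fin fineK ?fin_num_measure//.
  exact: probability_le1.
move=> delta0.
(* L stands for log n, so that t L is the volume (1 + e) (log n) / n. *)
pose t L := (1 + e) * (L * expR (- L)) : R.
have t_small b : 0 < b -> \forall L \near +oo, t L <= b.
  move=> b0; have b1 : 0 < b / (1 + e) by rewrite divr_gt0// addr_gt0.
  near=> L; rewrite /t mulrC -ler_pdivlMr ?addr_gt0//.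
  by near: L; exact: near_mul_expRN.
pose Q L := [/\ 1 <= L, t L <= e ^+ 2 / 2, t L <= (rho / (2 * M)) ^+ d &
   (1 + e) * (4 / e ^+ 2) / kappa / delta <= e ^+ 2 / 4 * L].
have QL : \forall L \near +oo, Q L.
  near=> L; split.
  - by near: L; exact: nbhs_pinfty_ge.
  - by near: L; apply: t_small; rewrite divr_gt0.
  - by near: L; apply: t_small; rewrite exprn_gt0.
  - by near: L; apply: le_near_pinfty_mulN; rewrite divr_gt0.
near=> n.
have : Q (ln n%:R) by near: n; exact: near_ln_nat.
have n0 : (0 < n)%N by near: n; exact: nbhs_infty_gt.
have [thr0 thrt] : 0 <= thr n /\ thr n < (1 + e) * (ln n%:R / n%:R).
  by near: n.
have nL : n%:R = expR (ln n%:R) :> R by rewrite lnK// posrE ltr0n.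
rewrite {2}nL -expRN -/(t _) in thrt.
move: nL thrt; rewrite /E; move: (ln n%:R) (thr n) thr0.
move=> L b b0 nL bt [L1 te te_rho Lbig].
have L0 : 0 < L := lt_le_trans ltr01 L1.
have t0 : 0 < t L := le_lt_trans b0 bt.
have ut : (1 - e) * t L <= e ^+ 2 / 2.
  by rewrite (le_trans _ te)// ler_piMl// ?(ltW t0)//; lra.
have u1 : (1 - e) * t L < 1 by rewrite (le_lt_trans ut)//; lra.
have [s0 s00 s0E] := exists_root d_gt0 b0.
have [s s_ge0 sE] := exists_root d_gt0 (ltW t0).
have s0s : s0 < s by rewrite -(@ltr_pXn2r _ d) ?nnegrE// s0E sE.
have s_gt0 := le_lt_trans s00 s0s.
have -> : [set w | b < max_spacing_volume A K (X ^~ w) n] =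
          [set w | s0 < max_spacing A K [set X i w | i in `I_n]].
  apply/seteqP; split => w /=; rewrite /max_spacing_volume -s0E;
  by rewrite ltr_pXn2r ?nnegrE// max_spacing_ge0.
split; first exact: measurable_lt_max_spacing.
have x1 : 1 <= rho / (2 * M) / s.
  rewrite ler_pdivlMr// mul1r -(@ler_pXn2r _ d) ?nnegrE ?(ltW rM0)//.
  by rewrite sE.
have [m [m_ge m_le]] := exists_nat_half x1.
have mr : 2 * M * s * m%:R <= r / d%:R.
  move: m_le; rewrite ler_pdivlMr// ler_pdivlMr ?mulr_gt0//.
  by apply: le_trans; rewrite le_eqVlt; apply/orP; left; apply/eqP; ring.
have md : kappa / t L <= m%:R ^+ d.
  rewrite -sE /kappa -expr_div_n lerXn2r ?nnegrE//.
    by rewrite ltW// divr_gt0// divr_gt0.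
  by rewrite mulrAC.
have := small_max_spacing_bound n iidX fX A1 AM M0 (ltW r_gt0) cK fq q0 s00
  s0s _ mr.
rewrite sE => /(_ (ltW u1)).
set p := fine _ => bound.
have p1 : 0 <= 1 - p.
  have mE := measurable_lt_max_spacing n s00.
  rewrite subr_ge0 -lee_fin fineK ?fin_num_measure//.
  exact: probability_le1.
have := void_probability_rate nL e0 e12 L0 ut; rewrite -/(t L).
set x := expR _; set z := (1 - _) ^+ n in bound * => rate.
have z0 : 0 < z by rewrite exprn_gt0// subr_gt0.
have xbig : (1 + e) * (4 / e ^+ 2) / kappa / delta * x <= 1.
  rewrite /x expRN ler_pdivrMr ?expR_gt0// mul1r (le_trans Lbig)//.
  by apply: le_trans (expR_ge1Dx _); rewrite lerDr.
have h1 : kappa * z * (1 - p) <= t L.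
  rewrite -[leRHS]mul1r -ler_pdivrMr// (le_trans _ bound)//.
  rewrite (_ : _ / _ = kappa / t L * z * (1 - p)).
    by rewrite ler_wpM2r// ler_wpM2r// ltW.
  by field; rewrite gt_eqF.
have h2 : z * (e ^+ 2 / 4 * kappa * (1 - p)) <= z * ((1 + e) * x).
  rewrite [leRHS]mulrC (le_trans _ rate)//.
  rewrite (_ : z * _ = e ^+ 2 / 4 * (kappa * z * (1 - p))); last by ring.
  by rewrite ler_wpM2l// divr_ge0// ltW.
rewrite ler_pM2l// in h2.
rewrite -(@ler_pM2l _ (e ^+ 2 / 4 * kappa)) ?mulr_gt0 ?divr_gt0//.
rewrite (le_trans h2)// -subr_ge0.
rewrite (_ : _ - _ = e ^+ 2 / 4 * kappa * delta *
  (1 - (1 + e) * (4 / e ^+ 2) / kappa / delta * x)).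
  by rewrite mulr_ge0 ?subr_ge0// !mulr_ge0// ltW.
by field; rewrite !gt_eqF.
Unshelve. all: by end_near. Qed.

End max_spacing_probability.

(** * Points with a density below one on a ball *)

Theorem theorem1p1 (R : realType) (d : nat) (d_ge1 : (1 <= d)%N)
    (K : set 'rV[R]_d) (K_bounded : bounded_set K)
    (K_vol : lebesgue_rV K = 1%E)
    (K_boundary : lebesgue_rV (boundary K) = 0%E)
    (A : set 'rV[R]_d) (A_bounded : bounded_set A)
    (A_convex : convex_set (A : set (convex_lmodType 'rV[R]_d)))
    (A_interior : A° !=set0) (A_vol : lebesgue_rV A = 1%E)
    (beta : R) (betaP : janson_constant A beta)
    (alpha : R) (alpha_gt0 : 0 < alpha) (alpha_lt1 : alpha < 1)
    (g : R) (gP : gumbel_cdf g = 1 - alpha)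
    (dO : measure_display) (Omega : measurableType dO)
    (P : probability Omega R)
    (X : nat -> {RV P >-> 'rV[R]_d}) (X_iid : iid X)
    (X_in_K : forall i w, K (X i w))
    (f : 'rV[R]_d -> R) (f_density : has_lebesgue_density (X 0%N) f)
    (eps : R) (eps_gt0 : 0 < eps)
    (c : 'rV[R]_d) (r : R) (r_gt0 : 0 < r)
    (S_sub_K : euclidean_ball c r `<=` K)
    (f_small : forall x, euclidean_ball c r x -> f x <= 1 - eps) :
  P [set w | (g + ln n%:R + (d%:R - 1) * ln (ln n%:R) + beta) / n%:R
               < max_spacing_volume A K (X ^~ w) n]
    @[n --> \oo] --> 1%E.
Proof.
(* Lowering eps keeps the density bound and makes 1 - e nonnegative. *)
pose e := Num.min eps (1 / 2).
have e0 : 0 < e by rewrite lt_min eps_gt0 divr_gt0.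
have e12 : e <= 1 / 2 by rewrite ge_min lexx orbT.
have fq x : euclidean_ball c r x -> f x <= 1 - e.
  by move/f_small/le_trans; apply; rewrite lerD2l lerN2 ge_min lexx.
apply: (lt_max_spacing_volume_whp d_ge1 K_bounded A_convex A_interior X_iid
  f_density A_bounded A_vol r_gt0 S_sub_K e0 e12 fq).
have d1 : 0 <= d%:R - 1 :> R by rewrite subr_ge0 ler1n.
pose Q L : Prop := [/\ 1 <= L, g + beta + (d%:R - 1) * ln L < e * L &
  `|g + beta| <= L].
have QL : \forall L \near +oo, Q L.
  near=> L; split.
  - by near: L; exact: nbhs_pinfty_ge.
  - have h1 : g + beta + 1 <= e / 2 * L.
      by near: L; apply: le_near_pinfty_mulN; rewrite divr_gt0.
    have h2 : (d%:R - 1) * ln L <= e / 2 * L.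
      by near: L; apply: near_ln_le => //; rewrite divr_gt0.
    by lra.
  - by near: L; exact: nbhs_pinfty_ge.
near=> n.
have [L1 thrL gL] : Q (ln n%:R) by near: n; exact: near_ln_nat.
have nR0 : (0 : R) < n%:R by rewrite ltr0n; near: n; exact: nbhs_infty_gt.
have lnL : 0 <= (d%:R - 1) * ln (ln n%:R) :> R by rewrite mulr_ge0// ln_ge0.
split.
  rewrite divr_ge0 ?(ltW nR0)//.
  by move: gL; rewrite ler_norml => /andP[+ _]; lra.
by rewrite mulrA ltr_pM2r ?invr_gt0//; lra.
Unshelve. all: by end_near. Qed.
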